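(* Let $$g_0(x)=-\sqrt{LW\left(\frac{1}{2\pi x^2}\right)},\qquad g_1(x)=\sqrt{LW\left(\frac{1}{2\pi (x-1)^2}\right)},\qquad 0<x<1.$$ Then $$S(x)\sim g_0(x)\quad\text{as } x\to 0^+,\qquad S(x)\sim g_1(x)\quad\text{as } x\to 1^-.$$ Moreover, both functions $g=g_0$ and $g=g_1$ satisfy on $(0,1)$ the ordinary differential equation $$g''=g\,(g')^2\left[1+\frac{2}{g^2(1+g^2)}\right],$$ whose right-hand side satisfies $g(g')^2\left[1+\frac{2}{g^2(1+g^2)}\right]\sim g\,(g')^2$ as $|g|\to\infty$.
   Context: $N:\mathbb{R}\to(0,1)$ is $N(x)=\frac{1}{\sqrt{2\pi}}\int_{-\infty}^{x}e^{-t^2/2}\,dt$, and $S:(0,1)\to\mathbb{R}$ denotes its inverse. $LW$ denotes the Lambert W function: for $y>0$, $LW(y)$ is the unique positive real number with $LW(y)e^{LW(y)}=y$. The notation $f\sim h$ means that $f/h\to 1$ in the indicated limit. *)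

(* Defs.v *)
From mathcomp Require Import all_boot all_order all_algebra.
From mathcomp Require Import all_classical all_reals all_analysis.
Set Implicit Arguments.
Unset Strict Implicit.
Unset Printing Implicit Defensive.
Import Order.TTheory GRing.Theory Num.Theory.
Import numFieldNormedType.Exports.
Local Open Scope classical_set_scope.
Local Open Scope ring_scope.

Definition normal_cdf {R : realType} (x : R) : R :=
  (Num.sqrt (2 * pi))^-1 *
  Rintegral lebesgue_measure `]-oo, x] (fun t : R => expR (- t ^+ 2 / 2)).

(* The inverse S of normal_cdf, as a total function; its value at x is
   meaningful for 0 < x < 1 only (outside this interval it is the default 0). *)
Definition normal_quantile {R : realType} (x : R) : R :=
  xget 0 [set t : R | normal_cdf t = x].

(* Meaningful for 0 < y only. *)
Definition lambertW {R : realType} (y : R) : R :=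
  xget 0 [set w : R | 0 < w /\ w * expR w = y].

Definition g0 {R : realType} (x : R) : R :=
  - Num.sqrt (lambertW (2 * pi * x ^+ 2)^-1).

Definition g1 {R : realType} (x : R) : R :=
  Num.sqrt (lambertW (2 * pi * (x - 1) ^+ 2)^-1).

(* f ~ h along F, in the sense f / h --> 1; since y / 0 = 0, this forces h to
   be eventually nonzero. *)
Definition asymp_equiv {R : realType} {T : Type} (F : set_system T)
  (f h : T -> R) : Prop := f t / h t @[t --> F] --> (1 : R).

(* The filter "`|u t| --> +oo with t in D". *)
Definition norm_pinfty {R : realType} {T : Type} (D : set T) (u : T -> R) :
    set_system T :=
  filter_from [set: R] (fun M => [set t | D t /\ M < `|u t|]).

(* The right-hand side of the equation as a function of u = g and p = g'. *)
Definition ode_rhs {R : realType} (u p : R) : R :=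
  u * p ^+ 2 * (1 + 2 / (u ^+ 2 * (1 + u ^+ 2))).

Definition ode_solution {R : realType} (D : set R) (g : R -> R) : Prop :=
  forall x, D x ->
    [/\ derivable g x 1, derivable (derive1 g) x 1 &
        derive1 (derive1 g) x = ode_rhs (g x) (derive1 g x)].

(* Main.v *)
Require Import Defs.
From HB Require Import structures.
From mathcomp Require Import all_boot all_order all_algebra.
From mathcomp Require Import all_classical all_reals all_analysis.
From mathcomp Require Import ring.
Import Order.TTheory GRing.Theory Num.Theory.
Import numFieldNormedType.Exports.
Local Open Scope classical_set_scope.
Local Open Scope ring_scope.

(** Let phi be the standard normal density and [mills u = - phi u / u].
    Squaring [mills u = x] and inverting gives
    [u ^ 2 * exp (u ^ 2) = 1 / (2 pi x ^ 2)], so [g0] is exactly the inverse of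
    [mills] on the negative half-line, while the Mills bounds say that
    [normal_cdf] is squeezed between [mills u * u ^ 2 / (1 + u ^ 2)] and
    [mills u] there; hence the asymptotic equivalence at 0.  The one at 1
    follows from [g1 x = - g0 (1 - x)] and the symmetry of the normal law.
    Differentiating the inverse gives the first-order equation
    [g' = - g / ((x - c) (1 + g ^ 2))] with [c = 0] for [g0] and [c = 1] for
    [g1], and differentiating once more eliminates [x]. *)

(** * Monotonicity from the sign of a derivative *)

Section monotone.
Context {R : realType}.
Implicit Types f df : R -> R.

Lemma is_derive_gt0_lt f df (D : interval R) :
  {in D, forall x : R, is_derive x 1 f (df x)} -> {in D, forall x, 0 < df x} ->
  {in D &, {homo f : x y / x < y}}.
Proof.
move=> fd df0 x y xD yD xy.
have sD z : z \in `[x, y] -> z \in D.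
  exact: (@interval_is_interval _ D x y xD yD z).
have [||z zxy E] := @MVT R f df x y xy.
- by move=> z zxy; apply/fd/sD/subset_itv_oo_cc.
- apply: derivable_within_continuous => z /sD zD.
  by have [] := fd z zD.
- rewrite -subr_gt0 E mulr_gt0 ?subr_gt0// df0//.
  exact/sD/subset_itv_oo_cc.
Qed.

(** By the mean value theorem [f] is nondecreasing left of [b], so its limit at [-oo] is a lower
    bound. With [l = 0] and [f] a difference of two functions, this proves each of the Mills
    bounds. *)
Lemma is_derive_ge0_cvgNy f df (b l : R) :
  (forall x : R, x < b -> is_derive x 1 f (df x)) ->
  (forall x, x < b -> 0 <= df x) ->
  f x @[x --> -oo] --> l -> forall x, x < b -> l <= f x.
Proof.
move=> fd df0 fl x xb.
apply: (ler_cvg_to fl (cvg_cst (f x))); near=> y.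
have yx : y <= x by near: y; apply: nbhs_ninfty_le; exact: num_real.
have itvb z : z \in `]y, x[ -> z < b.
  by rewrite in_itv/= => /andP[_ zx]; exact: lt_trans zx xb.
have cvb z : z \in `[y, x] -> z < b.
  by rewrite in_itv/= => /andP[_ zx]; exact: le_lt_trans zx xb.
have [||z zyx E] := @MVT_segment R f df y x yx.
- by move=> z /itvb; exact: fd.
- apply: derivable_within_continuous => z /cvb zb.
  by have [] := fd z zb.
- by rewrite -subr_ge0 E mulr_ge0 ?subr_ge0 ?df0 ?cvb.
Unshelve. all: by end_near. Qed.

End monotone.

(** * The standard normal density and distribution function *)

Section gauss.
Context {R : realType}.
Implicit Types x u : R.
Notation phi := (@normal_pdf R 0 1).

Lemma sqrt2pi_gt0 : 0 < Num.sqrt (2 * pi) :> R.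
Proof. by rewrite sqrtr_gt0 mulr_gt0 ?pi_gt0. Qed.

Lemma sqrt2pi_neq0 : Num.sqrt (2 * pi) != 0 :> R.
Proof. by rewrite gt_eqF ?sqrt2pi_gt0. Qed.

Lemma normal_pdf01E x : phi x = (Num.sqrt (2 * pi))^-1 * expR (- x ^+ 2 / 2).
Proof.
rewrite normal_pdfE ?oner_neq0// /normal_peak /normal_fun subr0 !expr1n mul1r.
by rewrite mulr_natl.
Qed.

Lemma normal_pdf01_gt0 x : 0 < phi x.
Proof.
by rewrite normal_pdf01E mulr_gt0 ?expR_gt0// invr_gt0 sqrt2pi_gt0.
Qed.

Lemma normal_pdf01N x : phi (- x) = phi x.
Proof. by rewrite !normal_pdf01E sqrrN. Qed.

Lemma is_derive_normal_pdf01 x : is_derive x 1 phi (- x * phi x).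
Proof.
have -> : phi = fun x => (Num.sqrt (2 * pi))^-1 * expR (- x ^+ 2 / 2).
  by apply/funext => ?; exact: normal_pdf01E.
apply: is_derive_eq.
by rewrite /GRing.scale/=; field; exact: sqrt2pi_neq0.
Qed.

(** Gives access to the measure-theoretic facts about [normal_prob]: finiteness, limits of
    distribution functions, complements. *)
Lemma normal_cdfE x : (normal_cdf x)%:E = normal_prob 0 1 `]-oo, x].
Proof.
rewrite /normal_prob -[RHS]fineK//; last first.
  exact: (fin_num_measure (normal_prob 0 1)).
congr (_%:E).
have c0 := invr_neq0 sqrt2pi_neq0.
rewrite /normal_cdf -RintegralZl//.
  by apply: eq_Rintegral => t _; rewrite normal_pdf01E.
apply: (@integrableS _ _ _ _ setT) => //.
rewrite (_ : EFin \o _ =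
    fun t => (((Num.sqrt (2 * pi))^-1)^-1%:E * (phi t)%:E)%E).
  by apply: integrableZl => //; exact: integrable_normal_pdf.
by apply/funext => t/=; rewrite normal_pdf01E -EFinM mulKf.
Qed.

(** The identity, seen as a random variable under [normal_prob 0 1], has [normal_cdf] as its
    distribution function. *)
Let idTR : measurableTypeR R -> R := idfun.

#[local] HB.instance Definition _ :=
  @isMeasurableFun.Build _ _ _ _ idTR (@measurable_id _ _ setT).

Lemma normal_cdf_cvgNy : normal_cdf x @[x --> -oo] --> (0 : R).
Proof.
have := fine_cvg (cvg_cdfNy0 (idTR : {RV (normal_prob 0 1) >-> R})).
move=> /(_ _); apply: cvg_trans; apply: near_eq_cvg; near=> x.
by rewrite /= /cdf /distribution /pushforward preimage_id -normal_cdfE.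
Unshelve. all: by end_near. Qed.

Lemma normal_cdf_ge0 x : 0 <= normal_cdf x.
Proof. by rewrite -lee_fin normal_cdfE measure_ge0. Qed.

Lemma normal_cdfEint x :
  normal_cdf x = \int[lebesgue_measure]_(t in `]-oo, x]) phi t.
Proof.
apply: EFin_inj; rewrite normal_cdfE /Rintegral fineK//.
exact: (fin_num_measure (normal_prob 0 1)).
Qed.

Lemma is_derive_normal_cdf x : is_derive x 1 normal_cdf (phi x).
Proof.
(* The bound [x + 1] only serves to place [x] inside the domain of integration. *)
have := @continuous_FTC1 R phi -oo%O x (x + 1).
rewrite ltrDl ltr01 => /(_ isT).
have phi_int : lebesgue_measure.-integrable `]-oo, x + 1] (EFin \o phi).
  by apply: (@integrableS _ _ _ _ setT) => //; exact: integrable_normal_pdf.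
have phi_cont := @continuous_normal_pdf R 0 1 (oner_neq0 _) x.
move=> /(_ phi_int (ltNyr _) phi_cont)/=.
rewrite -(_ : normal_cdf =
    fun y => \int[lebesgue_measure]_(t in `]-oo, y]) phi t); last first.
  by apply/funext => y; exact: normal_cdfEint.
by move=> [dN dNE]; apply: DeriveDef => //; rewrite -derive1E.
Qed.

Lemma normal_cdf_lt : {homo (@normal_cdf R) : x y / x < y}.
Proof.
move=> x y; apply: (@is_derive_gt0_lt R _ phi `]-oo, +oo[%R) => // z _.
- exact: is_derive_normal_cdf.
- exact: normal_pdf01_gt0.
Qed.

(** The substitution [t -> - t] preserves the even density and turns the left tail into a right
    tail, which is the complement of []-oo, x]] up to the null set [{x}]. *)
Lemma normal_cdfN x : normal_cdf (- x) = 1 - normal_cdf x.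
Proof.
apply: EFin_inj; rewrite EFinB !normal_cdfE.
transitivity (normal_prob 0 1 `[x, +oo[).
  rewrite /normal_prob ge0_integration_by_substitutionNy.
  - by apply: eq_integral => t _; rewrite /= normal_pdf01N.
  - by apply: continuous_subspaceT; exact: continuous_normal_pdf (oner_neq0 _).
  - by move=> t _; exact: normal_pdf_ge0.
transitivity (normal_prob 0 1 `]x, +oo[).
  rewrite /normal_prob integral_itv_obnd_cbnd//.
  apply: (@measurable_int _ _ _ lebesgue_measure).
  by apply: (@integrableS _ _ _ _ setT) => //; exact: integrable_normal_pdf.
by rewrite -probability_setC// setCitvl.
Qed.

Lemma normal_quantileK x : normal_quantile (normal_cdf x) = x.
Proof.
rewrite /normal_quantile; case: xgetP => [t _ /= E|/(_ x)[]//].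
by apply: inc_inj E; exact: le_mono normal_cdf_lt.
Qed.

End gauss.

(** * The Lambert W function on the positive half-line *)

Section lambert.
Context {R : realType}.
Implicit Types w x y : R.

Lemma mul_expR_inj : {in > 0 &, injective (fun w : R => w * expR w)}.
Proof.
apply: inc_inj_in; apply: le_mono_in => w x.
rewrite 2!unfold_in /= => w0 x0 wx.
by apply: ltr_pM; rewrite ?ltr_expR ?expR_ge0 ?ltW.
Qed.

Lemma lambertWK w : 0 < w -> lambertW (w * expR w) = w.
Proof.
move=> w0; rewrite /lambertW; case: xgetP => [t _ /= [t0 E]|/(_ w)/=[]//].
exact: mul_expR_inj.
Qed.

Lemma lambertWP y : 0 < y ->
  0 < lambertW y /\ lambertW y * expR (lambertW y) = y.
Proof.
move=> y0; suff [w w0 <-] : exists2 w, 0 < w & w * expR w = y.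
  by rewrite lambertWK.
(* The interval [[0, y]] is long enough because [y < y * expR y]. *)
have [||w] := @IVT R (fun w => w * expR w) 0 y y (ltW y0).
- apply: continuous_subspaceT => z; apply: cvgM => //; exact: continuous_expR.
- rewrite mul0r min_l ?max_r ?mulr_ge0 ?expR_ge0 ?ltW//=.
  by rewrite ltr_pMr// -expR0 ltr_expR.
- rewrite in_itv/= => /andP[w0 _] wE; exists w => //.
  rewrite lt0r w0 andbT; apply: contraTneq y0 => wz.
  by rewrite -wE wz mul0r ltxx.
Qed.

End lambert.

(** * The Mills function, its inverse [g0], and the Mills bounds *)

Section mills.
Context {R : realType}.
Implicit Types x u : R.
Notation phi := (@normal_pdf R 0 1).

Definition mills u : R := - (phi u / u).

Lemma mills_gt0 u : u < 0 -> 0 < mills u.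
Proof.
move=> u0; rewrite /mills -mulrN mulr_gt0 ?normal_pdf01_gt0//.
by rewrite oppr_gt0 invr_lt0.
Qed.

Lemma is_derive_mills u : u != 0 -> is_derive u 1 mills (phi u * (1 + u ^- 2)).
Proof.
move=> u0.
have dphi := is_derive_normal_pdf01 u.
have dV : is_derive u 1 (fun z : R => z^-1) (- u ^- 2).
  have := @is_deriveV R id u 1 1 u0 (is_derive_id u 1).
  by rewrite /GRing.scale/= mulr1.
rewrite /mills; apply: is_derive_eq.
by rewrite /GRing.scale/=; field.
Qed.

Lemma mills_lt : {in < 0 &, {homo mills : x y / x < y}}.
Proof.
move=> x y x0 y0; apply: (@is_derive_gt0_lt R _
  (fun u => phi u * (1 + u ^- 2)) `]-oo, 0[%R) => // z.
- by rewrite in_itv/= => z0; apply: is_derive_mills; rewrite lt_eqF.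
- by move=> _; rewrite mulr_gt0 ?normal_pdf01_gt0// ltr_wpDr// invr_ge0 sqr_ge0.
Qed.

Lemma sqr_mills u : u != 0 ->
  (2 * pi * mills u ^+ 2)^-1 = u ^+ 2 * expR (u ^+ 2).
Proof.
move=> u0; rewrite /mills normal_pdf01E sqrrN !exprMn !exprVn.
rewrite sqr_sqrtr ?mulr_ge0 ?pi_ge0//.
rewrite (_ : expR _ ^+ 2 = (expR (u ^+ 2))^-1); last first.
  by rewrite -expRN expr2 -expRD; congr expR; field.
have pi0 : pi != 0 :> R by rewrite gt_eqF ?pi_gt0.
have e0 : expR (u ^+ 2) != 0 by rewrite gt_eqF ?expR_gt0.
(* [field] would unfold [pi]. *)
by move: pi pi0 => p p0; field; rewrite u0 e0.
Qed.

Lemma g0_mills u : u < 0 -> g0 (mills u) = u.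
Proof.
move=> u0; have un0 : u != 0 by rewrite lt_eqF.
rewrite /g0 sqr_mills// lambertWK ?exprn_even_gt0//.
by rewrite sqrtr_sqr ltr0_norm// opprK.
Qed.

(** The Lambert equation shows that [mills (g0 x)] and [x] have the same square, and both are
    positive. *)
Lemma g0P x : 0 < x -> g0 x < 0 /\ mills (g0 x) = x.
Proof.
move=> x0.
have y0 : 0 < (2 * pi * x ^+ 2)^-1.
  by rewrite invr_gt0 !mulr_gt0 ?pi_gt0 ?exprn_gt0.
have [w0 wE] := lambertWP _ y0.
have g0_lt0 : g0 x < 0 by rewrite oppr_lt0 sqrtr_gt0.
split => //.
have /eqP : (2 * pi * mills (g0 x) ^+ 2)^-1 = (2 * pi * x ^+ 2)^-1.
  rewrite sqr_mills ?lt_eqF// -wE.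
  by rewrite sqrrN sqr_sqrtr// ltW.
have pi2_neq0 : 2 * pi != 0 :> R by rewrite gt_eqF// mulr_gt0 ?pi_gt0.
rewrite (inj_eq invr_inj) (inj_eq (mulfI pi2_neq0)).
by rewrite eqrXn2// ?(ltW x0) ?ltW ?mills_gt0// => /eqP.
Qed.

Lemma g1E x : g1 x = - g0 (1 - x).
Proof. by rewrite /g1 /g0 opprK -(sqrrN (x - 1)) opprB. Qed.

Lemma mills_cvgNy : mills u @[u --> -oo] --> (0 : R).
Proof.
apply/cvgrPdist_le => e e0; near=> u.
have u0 : u < 0 by near: u; apply: nbhs_ninfty_lt; exact: num_real.
(* The density is at most its peak, so [mills u] is at most the peak divided by [- u]. *)
have uN : u <= - (normal_peak 1 / e).
  by near: u; apply: nbhs_ninfty_le; exact: num_real.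
rewrite sub0r normrN gtr0_norm ?mills_gt0// /mills -mulrN -invrN.
rewrite ler_pdivrMr ?oppr_gt0//.
rewrite (le_trans (normal_pdf_ub _ _ _)) ?oner_neq0//.
by rewrite mulrC -ler_pdivrMr// lerNr.
Unshelve. all: by end_near. Qed.

(** The difference tends to 0 at [-oo] and has derivative [phi u / u ^ 2]. *)
Lemma normal_cdf_le_mills u : u < 0 -> normal_cdf u <= mills u.
Proof.
rewrite -subr_ge0; move: u.
apply: (@is_derive_ge0_cvgNy R (fun u => mills u - normal_cdf u)
    (fun u => phi u * (1 + u ^- 2) - phi u)) => [u|u|].
- move=> u0; apply: is_deriveB; last exact: is_derive_normal_cdf.
  by apply: is_derive_mills; rewrite lt_eqF.
- by rewrite subr_ge0 ler_pMr ?normal_pdf01_gt0// lerDl invr_ge0 sqr_ge0.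
- rewrite -[X in _ --> X](subr0 0); apply: cvgB; first exact: mills_cvgNy.
  exact: normal_cdf_cvgNy.
Qed.

(** The difference tends to 0 at [-oo], and its derivative simplifies to
    [2 phi u / (1 + u ^ 2) ^ 2]. *)
Lemma normal_cdf_ge u : u < 0 -> - u * phi u / (1 + u ^+ 2) <= normal_cdf u.
Proof.
pose k u := - u * phi u / (1 + u ^+ 2).
have p0 z : 0 < 1 + z ^+ 2 :> R by rewrite ltr_pwDl// sqr_ge0.
rewrite -subr_ge0; move: u.
apply: (@is_derive_ge0_cvgNy R (fun u => normal_cdf u - k u)
    (fun u => 2 * phi u / (1 + u ^+ 2) ^+ 2)) => [u|u|].
- move=> _.
  have dN := is_derive_normal_cdf u.
  have dphi := is_derive_normal_pdf01 u.
  have dV : is_derive u 1 (fun z : R => (1 + z ^+ 2)^-1)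
      (- (1 + u ^+ 2) ^- 2 * (2 * u)).
    have n0 : 1 + u ^+ 2 != 0 by rewrite gt_eqF.
    by apply: is_derive_eq; rewrite /GRing.scale/=; ring.
  apply: is_derive_eq.
  rewrite /GRing.scale/=; field.
  by rewrite gt_eqF.
- by move=> _; rewrite divr_ge0 ?sqr_ge0// mulr_ge0// normal_pdf_ge0.
- rewrite -[X in _ --> X](subr0 0); apply: cvgB; first exact: normal_cdf_cvgNy.
  (* On the negative half-line [k] lies between 0 and [mills]. *)
  apply: (squeeze_cvgr _ (cvg_cst 0) mills_cvgNy); near=> z.
  have z0 : z < 0 by near: z; apply: nbhs_ninfty_lt; exact: num_real.
  rewrite /k divr_ge0 ?mulr_ge0 ?normal_pdf_ge0 ?oppr_ge0 ?(ltW z0)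
    ?(ltW (p0 _))//=.
  rewrite ler_pdivrMr// (_ : mills z * _ = mills z + - z * phi z); last first.
    by rewrite /mills; field; rewrite lt_eqF.
  by rewrite lerDr ltW ?mills_gt0.
Unshelve. all: by end_near. Qed.

End mills.

(** * Asymptotics of the normal quantile at 0 and 1 *)

Section asymptotics.
Context {R : realType}.
Implicit Types x u : R.
Notation phi := (@normal_pdf R 0 1).

(** The hypothesis puts [1 - x], and by symmetry [x], in the range of [normal_cdf], where the
    quantile is a true inverse and not the default 0. *)
Lemma normal_quantileN x : (exists u, normal_cdf u = 1 - x) ->
  normal_quantile x = - normal_quantile (1 - x).
Proof.
case=> u uE; rewrite -uE normal_quantileK -[x](subKr 1) -uE -normal_cdfN.
exact: normal_quantileK.
Qed.

Lemma normal_cdf_surj u x : 0 < x < normal_cdf u ->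
  exists2 t, t < u & normal_cdf t = x.
Proof.
move=> /andP[x0 xu].
have [v [vu vx]] : exists v, v < u /\ normal_cdf v < x.
  near (ninfty_nbhs R)%R => v; exists v; split.
    by near: v; apply: nbhs_ninfty_lt; exact: num_real.
  by near: v; exact: (cvgr_lt 0 normal_cdf_cvgNy).
have [||t] := @IVT R normal_cdf v u x (ltW vu).
- apply: derivable_within_continuous => z _.
  by have [] := is_derive_normal_cdf z.
- have vuN := normal_cdf_lt _ _ vu.
  by rewrite min_l ?max_r ?(ltW vuN)// !ltW.
- rewrite in_itv/= => /andP[_]; rewrite le_eqVlt => /predU1P[->|tu tx].
    by move=> /esym ux; rewrite ux ltxx in xu.
  by exists t.
Unshelve. all: by end_near. Qed.

Lemma normal_cdf_gt0 u : 0 < normal_cdf u.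
Proof.
rewrite (le_lt_trans (normal_cdf_ge0 (u - 1)))// normal_cdf_lt//.
by rewrite ltrBlDr ltrDl.
Qed.

(* With [a = - s] and [b = - g0 (normal_cdf s)], the two Mills bounds give
   [a <= b] and [expR ((b^2 - a^2) / 2) <= 1 + a^-2]; then
   [1 + y <= expR y] turns the latter into [b^2 - a^2 <= 2 a^-2]. *)
Lemma g0_normal_cdf_bounds (s : R) : s < 0 ->
  1 - s ^- 4 <= s / g0 (normal_cdf s) <= 1.
Proof.
move=> s0.
have [g0_lt0 gE] := g0P _ (normal_cdf_gt0 s).
set g := g0 _ in g0_lt0 gE *.
have gs : g <= s.
  rewrite leNgt; apply/negP => sg.
  have := mills_lt _ _ s0 g0_lt0 sg.
  by rewrite gE ltNge normal_cdf_le_mills.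
have p0 : 0 < 1 + s ^+ 2 :> R by rewrite ltr_pwDl// sqr_ge0.
have sn0 : s != 0 by rewrite lt_eqF.
have E : expR ((g ^+ 2 - s ^+ 2) / 2) <= 1 + s ^- 2.
  have phiE : phi s = phi g * expR ((g ^+ 2 - s ^+ 2) / 2).
    by rewrite !normal_pdf01E -mulrA -expRD; congr (_ * expR _); field.
  have := normal_cdf_ge _ s0.
  rewrite -gE -/g /mills phiE -mulrN -invrN mulrCA -mulrA.
  rewrite ler_pM2l ?normal_pdf01_gt0// => H.
  set E := expR _ in H *; have E0 : 0 < E by exact: expR_gt0.
  have gN0 : 0 < - g by rewrite oppr_gt0.
  (* The lower Mills bound gives [E * (s * g) <= 1 + s ^ 2], and [s ^ 2 <= s * g] because
     [g <= s < 0]. *)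
  have {}H : E * s ^+ 2 <= 1 + s ^+ 2.
    apply: (@le_trans _ _ (E * (s * g))).
      by rewrite ler_pM2l// expr2 ler_nM2l.
    move: H; rewrite ler_pdivrMr// -(ler_pM2l gN0) mulVKf ?gt_eqF//.
    by rewrite (_ : - g * _ = E * (s * g))//; ring.
  rewrite -(@ler_pM2r _ (s ^+ 2)) ?exprn_even_gt0// (le_trans H)//.
  by rewrite mulrDl mul1r mulVf ?expf_neq0// addrC.
have D : g ^+ 2 - s ^+ 2 <= 2 / s ^+ 2.
  have := le_trans (expR_ge1Dx _) E.
  by rewrite lerD2l ler_pdivrMr// mulrC.
apply/andP; split; last first.
  by rewrite ler_ndivrMr// mul1r.
have s4 : 0 < s ^+ 4 by rewrite exprn_even_gt0.
have {}D : (g ^+ 2 - s ^+ 2) * s ^+ 2 <= 2.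
  by rewrite -ler_pdivlMr// exprn_even_gt0.
rewrite ler_ndivlMr// -subr_ge0 -(pmulr_lge0 _ s4).
rewrite (_ : _ * _ = (g - s) * s ^+ 4 - g); last by field.
(* Follows from [g ^ 2 - s ^ 2 = (s - g) ^ 2 + 2 s (g - s)]. Both summands are now visibly
   nonnegative: [D] bounds the only negative term of the bracket by 1. *)
have -> : (g - s) * s ^+ 4 - g = (s - g) +
    - s * (1 - (g ^+ 2 - s ^+ 2) * s ^+ 2 / 2 + (s - g) ^+ 2 * s ^+ 2 / 2).
  by field.
rewrite addr_ge0 ?subr_ge0// mulr_ge0 ?oppr_ge0 ?(ltW s0)//.
rewrite addr_ge0//; last by rewrite divr_ge0// -exprMn sqr_ge0.
by rewrite subr_ge0 ler_pdivrMr// mul1r.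
Qed.

(** Writing [x = normal_cdf s] turns the ratio into [s / g0 (normal_cdf s)], at distance at most
    [s ^- 4] from 1. *)
Lemma normal_quantile_equiv0 : asymp_equiv (0 : R)^'+ normal_quantile g0.
Proof.
apply/cvgrPdist_le => e e0; near=> x.
(* [M >= 1] gives [s ^ 4 >= - s >= M] whenever [s < - M], and [M >= e^-1] then gives
   [s ^- 4 <= e]. *)
pose M : R := 1 + e^-1.
have M1 : 1 <= M by rewrite lerDl invr_ge0 ltW.
have [|s sM sE] := normal_cdf_surj (- M) x.
  apply/andP; split; first by near: x; exact: nbhs_right_gt.
  near: x; apply: nbhs_right_lt; exact: normal_cdf_gt0.
have s0 : s < 0 by rewrite (lt_le_trans sM)// oppr_le0 (le_trans ler01).
rewrite -sE normal_quantileK.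
have /andP[lo hi] := g0_normal_cdf_bounds _ s0.
rewrite ger0_norm ?subr_ge0// lerBlDr -lerBlDl (le_trans _ lo)//.
rewrite lerD2l lerN2.
have s4 : M <= s ^+ 4.
  rewrite (_ : s ^+ 4 = (- s) ^+ 4); last by ring.
  have sM' : M <= - s by rewrite lerNr ltW.
  by rewrite (le_trans sM')// ler_eXnr// (le_trans M1).
rewrite -[leRHS]invrK lef_pV2 ?posrE ?invr_gt0//.
  by rewrite (le_trans _ s4)// lerDr.
by rewrite (lt_le_trans _ s4)// (lt_le_trans _ M1).
Unshelve. all: by end_near. Qed.

Lemma normal_quantile_equiv1 : asymp_equiv (1 : R)^'- normal_quantile g1.
Proof.
apply/cvgrPdist_le => e e0; apply/nbhs_left0P.
have := @normal_quantile_equiv0 => /cvgrPdist_le/(_ _ e0).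
apply: filter_app; near=> x => xe.
rewrite g1E normal_quantileN subKr; first by rewrite invrN mulrNN.
(* For [x] near 0, [x < normal_cdf 0], so [x] is a value of [normal_cdf], as the reflection formula
   requires. *)
have [|t _ tE] := normal_cdf_surj 0 x; last by exists t.
apply/andP; split; first by near: x; exact: nbhs_right_gt.
by near: x; apply: nbhs_right_lt; exact: normal_cdf_gt0.
Unshelve. all: by end_near. Qed.

End asymptotics.

(** * The differential equation and the asymptotics of its right-hand side *)

Section ode.
Context {R : realType}.
Implicit Types (x c : R) (g : R -> R).

Lemma norm_pinfty_filter (T : Type) (D : set T) (u : T -> R) :
  Filter (norm_pinfty D u).
Proof.
apply: filter_from_filter; first by exists 0.
move=> M N _ _; exists (Num.max M N) => // t [Dt].
by rewrite gt_max => /andP[].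
Qed.

Lemma is_derive_ode_solution g c (D : set R) : open D ->
  (forall x, D x -> [/\ x != c, g x != 0 &
     is_derive x 1 g (- g x / ((x - c) * (1 + g x ^+ 2)))]) ->
  ode_solution D g.
Proof.
move=> oD Dg x Dx.
have [xc gx0 dg] := Dg x Dx.
have p0 : 1 + g x ^+ 2 != 0 :> R by rewrite gt_eqF// ltr_pwDl// sqr_ge0.
have xc0 : x - c != 0 by rewrite subr_eq0.
(* To be differentiated, the formula for [g'] must hold in a neighbourhood of [x]; this is where [D]
   being open enters. *)
have near_g' : \forall y \near x,
    - g y / ((y - c) * (1 + g y ^+ 2)) = derive1 g y.
  apply: filterS (open_nbhs_nbhs (conj oD Dx)) => y /Dg[_ _ dy].
  by rewrite derive1E derive_val.
have d2 : is_derive x 1 (fun y => - g y / ((y - c) * (1 + g y ^+ 2)))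
    (ode_rhs (g x) (- g x / ((x - c) * (1 + g x ^+ 2)))).
  have n0 : (x - c) * (1 + g x ^+ 2) != 0 by rewrite mulf_neq0.
  apply: is_derive_eq.
  rewrite /ode_rhs /GRing.scale/=; field.
  by rewrite gx0 p0 xc0.
have d3 := near_eq_is_derive near_g' d2.
split.
- by have [] := dg.
- by have [] := d3.
- rewrite derive1E derive1E.
  by rewrite (@derive_val _ _ _ _ _ _ _ d3) (@derive_val _ _ _ _ _ _ _ dg).
Qed.

Lemma is_derive_g0 x : 0 < x ->
  is_derive x 1 g0 (- g0 x / (x * (1 + g0 x ^+ 2))).
Proof.
move=> x0; have [g0_lt0 gE] := g0P _ x0.
have gn0 : g0 x != 0 by rewrite lt_eqF.
(* The relation [mills (g0 x) = x] eliminates the density, leaving an inverse derivative rational in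
   [x] and [g0 x]. *)
have phiE : normal_pdf 0 1 (g0 x) = - x * g0 x.
  by rewrite -[X in - X]gE /mills opprK mulfVK.
have p0 : 1 + g0 x ^+ 2 != 0 :> R by rewrite gt_eqF// ltr_pwDl// sqr_ge0.
(* The base point becomes [mills (g0 x)], the form expected by the inverse function rule. *)
rewrite -{1}gE; apply: is_derive_eq.
  apply: is_derive_inverse (is_derive_mills _ gn0) _.
  - by near=> u; apply: g0_mills; near: u; exact: lt_nbhsl.
  - near=> u; have u0 : u != 0 by rewrite lt_eqF//; near: u; exact: lt_nbhsl.
    apply: differentiable_continuous; apply/derivable1_diffP.
    by have [] := is_derive_mills _ u0.
  - rewrite mulf_neq0// gt_eqF ?normal_pdf01_gt0//.
    by rewrite ltr_wpDr// invr_ge0 sqr_ge0.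
rewrite phiE; field.
by rewrite gn0 p0 gt_eqF.
Unshelve. all: by end_near. Qed.

Lemma is_derive_g1 x : x < 1 ->
  is_derive x 1 g1 (- g1 x / ((x - 1) * (1 + g1 x ^+ 2))).
Proof.
move=> x1; have x0 : 0 < 1 - x by rewrite subr_gt0.
have p0 : 1 + g1 x ^+ 2 != 0 :> R by rewrite gt_eqF// ltr_pwDl// sqr_ge0.
have -> : @g1 R = fun x => - g0 (1 - x) by apply/funext => y; exact: g1E.
have dg := is_derive_g0 _ x0.
have df : is_derive x 1 (fun y : R => 1 - y) (-1).
  have := is_deriveB (is_derive_cst (1 : R) x 1) (is_derive_id x 1).
  by rewrite sub0r.
change (fun y => - g0 (1 - y)) with (- (g0 \o (fun y : R => 1 - y))).
apply: is_derive_eq.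
rewrite g1E sqrrN in p0; field.
by apply/and3P; split; [rewrite sqrrN|rewrite subr_eq0 lt_eqF|rewrite gt_eqF].
Qed.

Lemma g0_g1_derive g : g = g0 \/ g = g1 ->
  exists c, forall x, `]0, 1[%classic x ->
    [/\ x != c, g x != 0 &
     is_derive x 1 g (- g x / ((x - c) * (1 + g x ^+ 2)))].
Proof.
case=> ->; [exists 0|exists 1] => x /=; rewrite in_itv/= => /andP[x0 x1].
- have [g0_lt0 _] := g0P _ x0.
  by split; rewrite ?subr0; [rewrite gt_eqF|rewrite lt_eqF|exact: is_derive_g0].
- have [|g0_lt0 _] := g0P (1 - x); first by rewrite subr_gt0.
  by split; [rewrite lt_eqF|rewrite g1E oppr_eq0 lt_eqF|exact: is_derive_g1].
Qed.

(** Since [p] does not vanish, the ratio is exactly [1 + 2 / (u ^ 2 (1 + u ^ 2))]. The arbitrary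
    type [T] covers both [u = g], [p = g'] along a solution and independent [u], [p]. *)
Lemma ode_rhs_equiv (T : Type) (D : set T) (u p : T -> R) :
  (forall t, D t -> p t != 0) ->
  asymp_equiv (norm_pinfty D u) (fun t => ode_rhs (u t) (p t))
    (fun t => u t * p t ^+ 2).
Proof.
move=> Dp; have F := norm_pinfty_filter T D u.
apply/cvgrPdist_le => e e0.
(* Beyond this threshold [|u| > 1], so [u ^ 2 >= |u| >= 2 / e], and the excess over 1 is at most
   [2 / u ^ 2 <= e]. *)
exists (1 + 2 / e) => // t [/Dp pt0 ut].
have u1 : 1 < `|u t| by rewrite (le_lt_trans _ ut)// lerDl divr_ge0// ltW.
have u0 : u t != 0 by rewrite -normr_gt0 (lt_trans ltr01).
have p0 : 0 < 1 + u t ^+ 2 by rewrite ltr_pwDl// sqr_ge0.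
rewrite /ode_rhs mulrAC divff ?mulf_neq0 ?sqrf_eq0// mul1r opprD addNKr normrN.
rewrite ger0_norm; last by rewrite divr_ge0// mulr_ge0 ?sqr_ge0// ltW.
have u2 : 2 / e <= u t ^+ 2.
  rewrite -[u t ^+ 2]ger0_norm ?sqr_ge0// normrX expr2.
  by rewrite (le_trans (ltW (lt_trans _ ut))) ?ltrDr// ler_peMl// ltW.
rewrite ler_pdivrMr; last by rewrite mulr_gt0// exprn_even_gt0.
rewrite ler_pdivrMr// mulrC in u2; apply: (le_trans u2).
by rewrite ler_pM2l// ler_peMr ?sqr_ge0// lerDl sqr_ge0.
Qed.

End ode.

Theorem proposition21 (R : realType) :
  [/\ asymp_equiv (0 : R)^'+ normal_quantile g0,
      asymp_equiv (1 : R)^'- normal_quantile g1,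
      forall g : R -> R, g = g0 \/ g = g1 ->
        ode_solution `]0, 1[ g /\
        asymp_equiv (norm_pinfty `]0, 1[ g)
          (fun x => ode_rhs (g x) (derive1 g x))
          (fun x => g x * derive1 g x ^+ 2)
    & asymp_equiv
        (norm_pinfty [set z : R * R | z.2 != 0] (fun z : R * R => z.1))
        (fun z : R * R => ode_rhs z.1 z.2)
        (fun z : R * R => z.1 * z.2 ^+ 2)].
Proof.
split.
- exact: normal_quantile_equiv0.
- exact: normal_quantile_equiv1.
- move=> g /g0_g1_derive[c dg]; split.
    by apply: is_derive_ode_solution dg; exact: interval_open.
  (* The first-order equation shows that [g'] does not vanish, because [g] does not. *)
  apply: ode_rhs_equiv => x /dg[xc gx0 dgx].
  rewrite derive1E derive_val mulf_neq0 ?oppr_eq0// invr_neq0//.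
  rewrite mulf_neq0 ?subr_eq0//.
  by rewrite gt_eqF// ltr_pwDl// sqr_ge0.
- exact: ode_rhs_equiv.
Qed.
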